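(* Let $A=(a_i)_{i=1}^\infty$ be a sequence of non-negative integers and let $G$ be a group. For $1\le i<n$ let \[ e(n,i)=\gcd\Bigl\{\prod_{j\in J}a_j\ \Bigm|\ J\subseteq\{1,2,\ldots,n-1\},\ |J|=n-i\Bigr\}, \] and let $e(n,n)=1$. Then for every $n\ge1$, \[ G^{(n,A)}=\prod_{i=1}^n(G^{(i,0)})^{e(n,i)}. \]
   Context: For a group $G$, the lower central filtration is $G^{(1,0)}=G$, $G^{(n+1,0)}=[G^{(n,0)},G]$ for $n\ge1$. The $A$-filtration $G^{(n,A)}$, $n=1,2,\ldots$, is defined by $G^{(1,A)}=G$ and $G^{(n,A)}=(G^{(n-1,A)})^{a_{n-1}}[G^{(n-1,A)},G]$ for $n>1$. Here, for a subgroup $H$ and an integer $a\ge0$, $H^a$ denotes the subgroup generated by all $a$-th powers of elements of $H$, and $[H,K]$ is the subgroup generated by all commutators $[h,k]$, $h\in H$, $k\in K$. The gcd is taken to be the non-negative generator of the ideal generated by the given integers (so the gcd of zeros is $0$). *)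

(* Defs.v *)
From HB Require Import structures.
From mathcomp Require Import all_boot.
From mathcomp Require Import classical_sets.
Set Implicit Arguments.
Unset Strict Implicit.
Unset Printing Implicit Defensive.

Local Open Scope classical_set_scope.
Local Open Scope group_scope.

(* Groups may be infinite, so subgroups are classical sets of elements rather
   than the {group _} of finite group theory. *)

Definition generated (G : groupType) (X : set G) : set G :=
  smallest (fun H : set G => group_closed (mem H)) X.

Definition power_subgroup (G : groupType) (H : set G) (m : nat) : set G :=
  generated [set h ^+ m | h in H].

Definition commutator_subgroup (G : groupType) (H K : set G) : set G :=
  generated [set [~ h, k] | h in H & k in K].

(* The set of products, not the subgroup it generates. *)
Definition set_mulg (G : groupType) (H K : set G) : set G :=
  [set h * k | h in H & k in K].

(* The filtrations and the sequence a are indexed from 1: the 0-th terms of the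
   filtrations are junk values, and a 0 is never used. *)

Fixpoint lower_central (G : groupType) (n : nat) : set G :=
  match n with
  | 0 | 1 => [set: G]
  | m.+1 => commutator_subgroup (lower_central m) [set: G]
  end.
Arguments lower_central : clear implicits.

Fixpoint A_filtration (G : groupType) (a : nat -> nat) (n : nat) : set G :=
  match n with
  | 0 | 1 => [set: G]
  | m.+1 => set_mulg (power_subgroup (A_filtration a m) (a m))
                     (commutator_subgroup (A_filtration a m) [set: G])
  end.
Arguments A_filtration : clear implicits.

(* J ranges over the subsets of 'I_n = {0, ..., n-1} that avoid 0. *)
Definition e_coef (a : nat -> nat) (n i : nat) : nat :=
  if i == n then 1%N else
  (\big[gcdn/0]_(J : {set 'I_n} | [forall j in J, 0 < j] && (#|J| == n - i))
     \prod_(j in J) a j)%N.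

(* Main.v *)
Require Import Defs.
From HB Require Import structures.
From mathcomp Require Import all_boot.
From mathcomp Require Import boolp classical_sets.
Set Implicit Arguments.
Unset Strict Implicit.
Unset Printing Implicit Defensive.
Local Open Scope classical_set_scope.
Local Open Scope group_scope.

(** The idea is to compare both sides with the subgroup M n generated by the
    powers x ^+ e(n, i), for x in the i-th term gamma_i of the lower central
    series.

    Its generators for a fixed i generate a normal subgroup, so the product on
    the right-hand side is the subgroup M n ([big_power_subgroupE]). It remains
    to prove M n.+1 = (M n)^(a n) [M n, G] ([A_filtrationE]). The two sides are
    matched by the recurrence
      e(n+1, k+1) = gcd (a n * e(n, k+1), e(n, k))
    ([e_coef_rec]): among the products defining e(n+1, k+1), those with the factor
    a n match the a n-th powers of M n, and those without it match [M n, G], where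
    a commutator with an element of G goes from gamma_k to gamma_(k+1).

    If the powering maps were homomorphisms, this would be the whole proof. In
    general, [y^m, z] agrees with [y, z]^m, and (x y)^m with x^m y^m, only up to
    factors c_j ^ C(m, j) with j >= 2, where c_j lies deeper in the lower central
    series: in gamma_(i j + 1) for the first formula when y is in gamma_i, in
    gamma_(i j) for the second when x and y are in gamma_i. With m = e(n, i),
    these factors belong to the right subgroups because
      e(n, i j) divides C(e(n, i), j)
    ([e_coef_dvd_bin]). This in turn holds because m divides j C(m, j), so that
    C(m, j) loses at most v_p(j) < j factors p of m, whereas, when p divides
    e(n, k+1), e(n, k) has at least one more factor p than e(n, k+1)
    ([prime_e_coef_dvdS]).

    These two formulas are not written out. Each one says that a certain
    sequence, such as k |-> [y^k, z], has a Taylor expansion: it is a product of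
    sequences k |-> c_j ^ C(k, j). This is true of all polynomial sequences, those
    whose j-th iterated differences lie in the term of weight w + p j of a
    filtration, and polynomial sequences are stable under products, inverses and
    commutators, by an argument of Lazard and Leibman ([poly_seq_closed],
    [poly_seq_value_mem]). *)

(** * The exponents e(n, i) *)

Section Arithmetic.
Local Open Scope nat_scope.
Variable a : nat -> nat.
Implicit Types (n i j k p d c : nat) (B : pred nat).

(** Index sets are traded for predicates on nat, whose type does not
    depend on n, so that n and n + 1 can be compared. The factor c is there because a multiple
    of a gcd appears in the recurrence. *)
Lemma dvdn_e_coef c n i d : i <= n ->
  (d %| c * e_coef a n i) <->
  (forall B, ~~ B 0 -> \sum_(k < n) B k = n - i ->
     d %| c * \prod_(k < n) (if B k then a k else 1)).
Proof.
move=> le_in; rewrite /e_coef; case: eqP => [->|/eqP neq_in].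
  rewrite subnn; split=> [dvd_d B _ /eqP|/(_ pred0)].
    rewrite sum_nat_eq0 => /forallP B0.
    by rewrite big1 // => k _; move: (B0 k); case: (B k).
  by rewrite big1 // big1 //; apply.
have prodE B (J : {set 'I_n}) : (forall k : 'I_n, B k = (k \in J)) ->
    \prod_(k in J) a k = \prod_(k < n) (if B k then a k else 1).
  by move=> BJ; rewrite big_mkcond /=; apply: eq_bigr => k _; rewrite BJ.
have sumBE B (J : {set 'I_n}) : (forall k : 'I_n, B k = (k \in J)) ->
    \sum_(k < n) B k = #|J|.
  move=> BJ; rewrite -sum1_card [RHS]big_mkcond /=; apply: eq_bigr => k _.
  by rewrite BJ; case: (k \in J).
rewrite (big_morph (muln c) (muln_gcdr c) (muln0 c)); split.
  move=> /dvdn_biggcdP dvd_d B B0 cardB.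
  pose J := finset (fun k : 'I_n => B k).
  have BJ (k : 'I_n) : B k = (k \in J) by rewrite inE.
  rewrite -(prodE _ _ BJ); apply: dvd_d; rewrite -(sumBE _ _ BJ) cardB eqxx andbT.
  by apply/forall_inP => k; rewrite inE lt0n; apply: contraTneq => ->.
move=> dvd_d; apply/dvdn_biggcdP => J /andP[/forall_inP J0 /eqP cardJ].
pose B k := [exists j in J, val j == k].
have BJ (k : 'I_n) : B k = (k \in J).
  apply/exists_inP/idP => [[j jJ /eqP/val_inj <-] //|kJ].
  by exists k.
rewrite (prodE _ _ BJ); apply: dvd_d; last by rewrite (sumBE _ _ BJ).
by apply/exists_inP => -[j /J0 j_gt0 /eqP j0]; rewrite j0 in j_gt0.
Qed.

Lemma e_coef_ge n i : n <= i -> e_coef a n i = 1.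
Proof.
move=> le_ni; rewrite /e_coef; case: eqP => // _.
apply/eqP; rewrite -dvdn1.
rewrite (bigD1 finset.set0) /=; first by rewrite big_set0 dvdn_gcdl.
rewrite cards0 eq_sym subn_eq0 le_ni andbT.
by apply/forall_inP => j; rewrite inE.
Qed.

(** There is no set of n indices among 1, ..., n - 1, and the empty gcd is 0. *)
Lemma e_coef0 n : 0 < n -> e_coef a n 0 = 0.
Proof.
case: n => // n _; apply/eqP; rewrite -dvd0n -[e_coef _ _ _]mul1n.
apply/dvdn_e_coef => // B /negbTE B0; rewrite big_ord_recl B0 subn0 => cardB.
suff: \sum_(k < n) B (lift ord0 k) <= n by rewrite -[X in X <= _]add0n cardB ltnn.
by rewrite -[leqRHS]card_ord -sum1_card leq_sum // => k _; case: (B _).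
Qed.

(** The sets of n - k indices among 1, ..., n are sorted according to whether they
    contain n. *)
Lemma e_coef_rec n k : 0 < n ->
  e_coef a n.+1 k.+1 = gcdn (a n * e_coef a n k.+1) (e_coef a n k).
Proof.
move=> n_gt0; have [le_nk|lt_kn] := leqP n k.
  by rewrite !e_coef_ge // ?gcdn1 // ltnW.
suff dvdE d : (d %| e_coef a n.+1 k.+1) =
              (d %| gcdn (a n * e_coef a n k.+1) (e_coef a n k)).
  by apply/eqP; rewrite eqn_dvd dvdE -dvdE !dvdnn.
pose upd B b l := if l == n then b else B l.
have updn B b : upd B b n = b by rewrite /upd eqxx.
have updl B b (l : 'I_n) : upd B b l = B l by rewrite /upd ltn_eqF.
have upd0 B b : upd B b 0 = B 0 by rewrite /upd ltn_eqF.
have sumE B b : \sum_(l < n.+1) upd B b l = \sum_(l < n) B l + b.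
  by rewrite big_ord_recr /= updn; under eq_bigr do rewrite updl.
have prodE B b : \prod_(l < n.+1) (if upd B b l then a l else 1) =
    (\prod_(l < n) (if B l then a l else 1)) * (if b then a n else 1).
  by rewrite big_ord_recr /= updn; under eq_bigr do rewrite updl.
have lt_kn1 : k < n.+1 by exact: ltnW.
rewrite dvdn_gcd -[e_coef _ _ k]mul1n -[e_coef _ n.+1 _]mul1n.
apply/idP/andP => [/(dvdn_e_coef _ _ lt_kn1) dvd_d|[]].
  split; [apply/(dvdn_e_coef _ _ lt_kn)|apply/(dvdn_e_coef _ _ (ltnW lt_kn))] =>
    B B0 cardB.
    have := dvd_d (upd B true); rewrite upd0 sumE prodE cardB mul1n mulnC.
    by apply=> //; rewrite addn1 subnS prednK // subn_gt0.
  have := dvd_d (upd B false); rewrite upd0 sumE prodE cardB muln1 addn0.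
  by apply=> //; rewrite subSS.
move=> /(dvdn_e_coef _ _ lt_kn) dvd_with /(dvdn_e_coef _ _ (ltnW lt_kn)) dvd_wo.
apply/dvdn_e_coef => // B B0; rewrite !big_ord_recr subSS /= mul1n.
case: (B n) => [|].
  rewrite addn1 => cardB; rewrite mulnC; apply: dvd_with => //.
  by rewrite subnS -cardB.
by rewrite addn0 muln1 -[X in _ %| X]mul1n; apply: dvd_wo.
Qed.

Lemma e_coef_dvdS n k : 0 < n -> e_coef a n k.+1 %| e_coef a n k.
Proof.
elim: n k => // -[|n] IHn [|k] _; rewrite ?(e_coef0 (n := _.+1)) ?dvdn0 //.
  by rewrite e_coef_ge.
rewrite !(e_coef_rec (n := n.+1)) // dvdn_gcd.
by rewrite (dvdn_trans (dvdn_gcdl _ _)) ?dvdn_mul ?IHn //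
           (dvdn_trans (dvdn_gcdr _ _)) ?IHn.
Qed.

Lemma e_coef_dvd n i j : 0 < n -> i <= j -> e_coef a n j %| e_coef a n i.
Proof.
move=> n_gt0 /subnK <-; elim: (j - i) => // t; apply: dvdn_trans.
by rewrite addSn e_coef_dvdS.
Qed.

Lemma e_coef_dvdSS n k : 0 < n -> e_coef a n.+1 k.+1 %| e_coef a n k.
Proof. by move=> n_gt0; rewrite e_coef_rec // dvdn_gcdr. Qed.

(** If p divides e(n, k+1), then no product of n - k - 1 of the a_j avoids p, so
    fewer than n - k - 1 of the a_j are prime to p. A product of n - k of the a_j
    then has a factor divisible by p whose removal leaves a multiple of e(n, k+1). The
    recurrence gives a proof without choosing indices. *)
Lemma prime_e_coef_dvdS p n k : prime p -> 0 < n ->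
  p %| e_coef a n k.+1 -> p * e_coef a n k.+1 %| e_coef a n k.
Proof.
move=> p_pr; elim: n k => // -[|n] IHn k _.
  by rewrite e_coef_ge // dvdn1 => /eqP p1; rewrite p1 in p_pr.
case: k => [|k]; first by rewrite (e_coef0 (n := _.+1)) ?dvdn0.
rewrite !(e_coef_rec (n := n.+1)) // !dvdn_gcd muln_gcdr => /andP[p_ae p_e].
apply/andP; split; last by rewrite (dvdn_trans (dvdn_gcdr _ _)) ?IHn.
have := p_ae; rewrite Euclid_dvdM // => /orP[p_a|p_e'].
  by rewrite (dvdn_trans (dvdn_gcdr _ _)) // dvdn_mul.
by rewrite (dvdn_trans (dvdn_gcdl _ _)) // mulnCA dvdn_mul ?IHn.
Qed.

Lemma prime_e_coef_dvd p n k t : prime p -> 0 < n ->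
  p %| e_coef a n (k + t) -> p ^ t * e_coef a n (k + t) %| e_coef a n k.
Proof.
move=> p_pr n_gt0; elim: t => [|t IHt]; first by rewrite addn0 mul1n.
rewrite addnS => p_e; apply: dvdn_trans (IHt _); last first.
  exact: dvdn_trans p_e (e_coef_dvdS _ _).
by rewrite expnSr -mulnA dvdn_mul // prime_e_coef_dvdS.
Qed.

(** With m = e(n, i), one has m %| j * 'C(m, j). At a prime p dividing e(n, i j),
    the surplus of at least i j - i >= j - 1 factors p of m over e(n, i j)
    compensates for the factors p of j. *)
Lemma e_coef_dvd_bin n i j : 0 < n -> 0 < i -> 0 < j ->
  e_coef a n (i * j) %| 'C(e_coef a n i, j).
Proof.
move=> n_gt0 i_gt0 j_gt0; set d := e_coef _ _ _; set m := e_coef a n i.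
have [->|C_gt0] := posnP 'C(m, j); first exact: dvdn0.
have m_gt0 : 0 < m by apply: leq_trans j_gt0 _; rewrite -bin_gt0.
have dvd_dm : d %| m by rewrite e_coef_dvd // leq_pmulr.
apply/dvdn_partP => [|p]; first exact: dvdn_gt0 dvd_dm.
rewrite mem_primes => /and3P[p_pr d_gt0 p_d].
rewrite p_part pfactor_dvdn //.
have le_iij : i <= i * j by rewrite leq_pmulr.
have := prime_e_coef_dvd (k := i) (t := i * j - i) p_pr n_gt0.
rewrite subnKC // -/d -/m => /(_ p_d) dvd_m.
have dvd_jC : m %| j * 'C(m, j).
  by case: (j) j_gt0 => // j' _; rewrite -mul_bin_diag dvdn_mulr.
have := dvdn_leq_log p _ (dvdn_trans dvd_m dvd_jC).
rewrite muln_gt0 j_gt0 C_gt0 => /(_ isT).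
rewrite !lognM // ?expn_gt0 ?prime_gt0 // pfactorK // => le_log.
have lt_logj : logn p j < j.
  apply: leq_trans (ltn_expl _ (prime_gt1 p_pr)) _.
  by rewrite dvdn_leq // pfactor_dvdnn.
have le_j : j.-1 <= i * j - i.
  by rewrite -[X in _ - X]muln1 -mulnBr subn1 leq_pmull.
rewrite -(leq_add2l (i * j - i)); apply: leq_trans le_log _.
by rewrite leq_add2r (leq_trans _ le_j) // -ltnS prednK.
Qed.
End Arithmetic.

(** * Subgroups of a possibly infinite group *)

(** Free reduction of words; it settles the identities that hold in free groups. *)
Ltac gsimpl :=
  rewrite /commg /conjg ?(invgM, invgK, invg1) -?mulgA
    ?(mulKg, mulVKg, mulgV, mulVg, mul1g, mulg1).

Section Subgroups.
Variable G : groupType.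
Implicit Types (H K N X : set G) (x y z : G).

Definition subgroup H := group_closed (mem H).
Definition normal H := subgroup H /\ forall x z, H x -> H (x ^ z).

Lemma subgroupP H :
  subgroup H <->
  [/\ H 1, forall x y, H x -> H y -> H (x * y) & forall x, H x -> H x^-1].
Proof.
split=> [H_gr|[H1 HM HV]].
  split; first by have [/set_mem] := H_gr.
    by move=> x y /mem_set Hx /mem_set Hy; apply: set_mem; exact: (group_closedM H_gr).
  by move=> x /mem_set Hx; apply: set_mem; exact: (group_closedV H_gr).
by split=> [|x y /set_mem Hx /set_mem Hy]; apply/mem_set => //; apply/HM/HV.
Qed.

Lemma subgroup1 H : subgroup H -> H 1.
Proof. by move=> /subgroupP[]. Qed.

Lemma subgroupM H x y : subgroup H -> H x -> H y -> H (x * y).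
Proof. by move=> /subgroupP[_ + _]; apply. Qed.

Lemma subgroupV H x : subgroup H -> H x -> H x^-1.
Proof. by move=> /subgroupP[_ _]; apply. Qed.

Lemma subgroupX H x m : subgroup H -> H x -> H (x ^+ m).
Proof.
move=> H_gr Hx; elim: m => [|m IHm]; first exact: subgroup1.
by rewrite expgS; apply: subgroupM.
Qed.

Lemma subgroupX_dvd H x m k : subgroup H -> (m %| k)%N -> H (x ^+ m) -> H (x ^+ k).
Proof. by move=> H_gr /dvdnP[q ->] Hx; rewrite mulnC expgnA; apply: subgroupX. Qed.

Lemma subgroupX_gcdn H x m k : subgroup H ->
  H (x ^+ m) -> H (x ^+ k) -> H (x ^+ gcdn m k).
Proof.
move=> H_gr Hm Hk; have [->|m_gt0] := posnP m; first by rewrite gcd0n.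
case: (egcdnP k m_gt0) => km kn eq_gcd _.
suff: H (x ^+ (km * m) * (x ^+ (kn * k))^-1).
  by rewrite eq_gcd addnC expgnDr mulgK.
apply: subgroupM => //; first by apply: subgroupX_dvd Hm; rewrite ?dvdn_mull.
by apply: subgroupV => //; apply: subgroupX_dvd Hk; rewrite ?dvdn_mull.
Qed.

Lemma normal_subgroup H : normal H -> subgroup H.
Proof. by case. Qed.

Lemma normal_commg_l H x z : normal H -> H x -> H [~ x, z].
Proof.
by move=> [H_gr HJ] Hx; apply: subgroupM => //; [apply: subgroupV|apply: HJ].
Qed.

(** Going from (x * y) ^+ k to (x * y) ^+ k.+1 only requires x to move past y ^+ k,
    whence the special form of the commutators. *)
Lemma expgM_mod N x y m : normal N -> (forall k, N [~ (y ^+ k)^-1, x^-1]) ->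
  N (x ^+ m) -> N (y ^+ m) -> N ((x * y) ^+ m).
Proof.
move=> [N_gr NJ] Nc Nx Ny.
suff ND k : N ((x * y) ^+ k * (x ^+ k * y ^+ k)^-1).
  by have := subgroupM N_gr (ND m) (subgroupM N_gr Nx Ny); rewrite mulgVK.
elim: k => [|k IHk]; first by rewrite !expg0 mulg1 mulgV; apply: subgroup1.
have := subgroupM N_gr IHk (NJ _ (x ^+ k)^-1 (Nc k)).
by congr N; rewrite !expgSr; gsimpl.
Qed.

Lemma generated_subgroup X : subgroup (generated X).
Proof.
apply/subgroupP; split=> [H [/= H_gr _]|x y Xx Xy H H_ok|x Xx H H_ok].
- exact: subgroup1.
- by apply: subgroupM (Xx _ H_ok) (Xy _ H_ok); case: H_ok.
- by apply: subgroupV (Xx _ H_ok); case: H_ok.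
Qed.

Lemma mem_generated X x : X x -> generated X x.
Proof. by move=> Xx H [_]; apply. Qed.

Lemma generated_sub X H : subgroup H -> X `<=` H -> generated X `<=` H.
Proof. exact: smallest_sub. Qed.

Lemma generated_normal X : (forall x z, X x -> X (x ^ z)) -> normal (generated X).
Proof.
move=> XJ; have X_gr := generated_subgroup X; split=> // x z; move: x.
apply: (@generated_sub X (fun x => generated X (x ^ z))) => [|x Xx]; last first.
  exact: mem_generated (XJ _ _ Xx).
apply/subgroupP; split=> [|u v Xu Xv|u Xu].
- by rewrite conj1g; apply: subgroup1 X_gr.
- by rewrite conjMg; apply: subgroupM X_gr Xu Xv.
- by rewrite conjVg; apply: subgroupV X_gr Xu.
Qed.

Lemma setT_normal : normal [set: G].
Proof. by split=> //; apply/subgroupP. Qed.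

Lemma power_subgroup_normal H m : normal H -> normal (power_subgroup H m).
Proof.
move=> [_ HJ]; apply: generated_normal => _ z [x Hx <-].
by exists (x ^ z); rewrite ?conjXg //; apply: HJ.
Qed.

Lemma commutator_subgroup_normal H K : normal H -> normal K ->
  normal (commutator_subgroup H K).
Proof.
move=> [_ HJ] [_ KJ]; apply: generated_normal => _ z [x Hx [y Ky <-]].
by exists (x ^ z); [apply: HJ|exists (y ^ z); [apply: KJ|rewrite conjRg]].
Qed.

Lemma commMg x y z : [~ x * y, z] = [~ x, z] ^ y * [~ y, z].
Proof. by gsimpl. Qed.

Lemma commVg x z : [~ x^-1, z] = [~ x, z]^-1 ^ x^-1.
Proof. by gsimpl. Qed.

Lemma centralised_mod_subgroup N H K : normal N -> subgroup H ->
  subgroup (fun x => H x /\ forall z, K z -> N [~ x, z]).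
Proof.
move=> [N_gr NJ] H_gr.
apply/subgroupP; split=> [|x y [Hx Nx] [Hy Ny]|x [Hx Nx]]; split.
- exact: subgroup1.
- by move=> z _; rewrite comm1g; apply: subgroup1.
- exact: subgroupM.
- by move=> z Kz; rewrite commMg; apply: subgroupM; [|apply/NJ/Nx|apply: Ny].
- exact: subgroupV.
- by move=> z Kz; rewrite commVg; exact: NJ (subgroupV N_gr (Nx _ Kz)).
Qed.

(** Modulo a normal subgroup N, the elements that commute with K form a subgroup. *)
Lemma commutator_generated N X K : normal N ->
  (forall x z, X x -> K z -> N [~ x, z]) ->
  forall x z, generated X x -> K z -> N [~ x, z].
Proof.
move=> N_nor NX x z Xx Kz.
have sgr := centralised_mod_subgroup K N_nor (generated_subgroup X).
have [_] : generated X x /\ forall z, K z -> N [~ x, z]; last exact.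
apply: generated_sub sgr _ _ Xx => y Xy; split; first exact: mem_generated.
by move=> t; apply: NX.
Qed.

Lemma set_mulg_normal H K : normal H -> normal K -> normal (set_mulg H K).
Proof.
move=> [H_gr HJ] [K_gr KJ]; split; last first.
  move=> _ z [x Hx [y Ky <-]].
  by exists (x ^ z); [apply: HJ|exists (y ^ z); [apply: KJ|rewrite conjMg]].
apply/subgroupP; split=> [|_ _ [x Hx [y Ky <-]] [x' Hx' [y' Ky' <-]]
                         |_ [x Hx [y Ky <-]]].
- by exists 1; [apply: subgroup1|exists 1; [apply: subgroup1|rewrite mul1g]].
- exists (x * x'); first exact: subgroupM.
  exists (y ^ x' * y'); first by apply: subgroupM => //; apply: KJ.
  by gsimpl.
- exists x^-1; first exact: subgroupV.
  exists (y^-1 ^ x^-1); first exact: KJ (subgroupV K_gr Ky).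
  by gsimpl.
Qed.

Lemma sub_set_mulg_l H K : K 1 -> H `<=` set_mulg H K.
Proof. by move=> K1 x Hx; exists x => //; exists 1; rewrite ?mulg1. Qed.

Lemma sub_set_mulg_r H K : H 1 -> K `<=` set_mulg H K.
Proof. by move=> H1 x Kx; exists 1 => //; exists x; rewrite ?mul1g. Qed.

Lemma set_mulg_sub H K N : subgroup N -> H `<=` N -> K `<=` N ->
  set_mulg H K `<=` N.
Proof.
by move=> N_gr HN KN _ [x Hx [y Ky <-]]; apply: subgroupM; [|apply: HN|apply: KN].
Qed.

Section BigProduct.
Variables (I : eqType) (H : I -> set G).
Hypothesis H_nor : forall i, normal (H i).
Let prodH r := \big[@set_mulg G/[set 1]]_(i <- r) H i.

Lemma big_set_mulg_normal (r : seq I) : normal (prodH r).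
Proof.
rewrite /prodH; elim: r => [|i r IHr]; rewrite ?(big_nil, big_cons).
  split=> [|_ z ->]; last by rewrite conj1g.
  by apply/subgroupP; split=> // [x y -> ->|x ->]; rewrite ?mul1g ?invg1.
exact: set_mulg_normal.
Qed.

Lemma sub_big_set_mulg (r : seq I) i : i \in r -> H i `<=` prodH r.
Proof.
rewrite /prodH; elim: r => // j r IHr; rewrite inE big_cons => /orP[/eqP->|ir].
  apply: sub_set_mulg_l.
  exact: subgroup1 (normal_subgroup (big_set_mulg_normal r)).
apply: subset_trans (IHr ir) _; apply: sub_set_mulg_r.
exact: subgroup1 (normal_subgroup (H_nor j)).
Qed.

Lemma big_set_mulg_sub (r : seq I) N : subgroup N ->
  (forall i, i \in r -> H i `<=` N) -> prodH r `<=` N.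
Proof.
rewrite /prodH => N_gr; elim: r => [|i r IHr] HN; rewrite ?(big_nil, big_cons).
  by move=> _ ->; apply: subgroup1.
apply: set_mulg_sub N_gr _ _; first by apply: HN; rewrite mem_head.
by apply: IHr => j jr; apply: HN; rewrite inE jr orbT.
Qed.

End BigProduct.
End Subgroups.

(** * Polynomial sequences in a filtered group *)

Section PolynomialSequences.
Variable G : groupType.
Implicit Types (f g : nat -> G) (w v p d k j m : nat) (N : set G).
Variable F : nat -> set G.
Hypothesis F_gr : forall w, subgroup (F w).
Hypothesis F_desc : forall w, F w.+1 `<=` F w.
Hypothesis F_comm : forall w v x y, F w x -> F v y -> F (w + v) [~ x, y].

Definition diff f : nat -> G := fun k => (f k)^-1 * f k.+1.

(** The iterated differences of f up to order d gain p in weight at each step,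
    starting from w. The bound d makes induction on the depth possible: the true
    polynomial sequences are those that satisfy this for all d. *)
Fixpoint poly_seq p w d f : Prop :=
  (forall k, F w (f k)) /\
  (if d is d'.+1 then poly_seq p (w + p) d' (diff f) else True).

Variable p : nat.

Lemma filtration_le w v x : w <= v -> F v x -> F w x.
Proof.
by move=> /subnK <-; elim: (v - w)%N => // t IHt /F_desc.
Qed.

Lemma poly_seq_le w v d f : w <= v -> poly_seq p v d f -> poly_seq p w d f.
Proof.
elim: d w v f => [|d IHd] w v f le_wv [Ff df].
  by split=> // k; exact: filtration_le (Ff k).
split=> [k|]; first exact: filtration_le (Ff k).
by apply: IHd df; rewrite leq_add2r.
Qed.

Lemma poly_seqW w d f : poly_seq p w d.+1 f -> poly_seq p w d f.
Proof.
elim: d w f => [|d IHd] w f [Ff df]; first by split.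
by split=> //; apply: IHd.
Qed.

(** The three stability properties are proved together by induction on d. Each
    difference of a product, inverse or commutator is a product of terms built from
    f, g and their differences, and these are polynomial up to order d by
    induction, with enough weight. For commutators the formula involves
    [~ f, g] itself, which is why the induction is on d and not on the weight: the
    property of [~ f, g] at order d is known when it is proved at order d + 1. *)
Lemma poly_seq_closed d :
  [/\ forall w f g, poly_seq p w d f -> poly_seq p w d g ->
        poly_seq p w d (fun k => f k * g k),
      forall w f, poly_seq p w d f -> poly_seq p w d (fun k => (f k)^-1)
    & forall w v f g, poly_seq p w d f -> poly_seq p v d g ->
        poly_seq p (w + v) d (fun k => [~ f k, g k])].
Proof.
elim: d => [|d [IHM IHV IHR]].
  split=> [w f g [Ff _] [Fg _]|w f [Ff _]|w v f g [Ff _] [Fg _]]; split=> // k.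
  - exact: subgroupM (F_gr w) (Ff k) (Fg k).
  - exact: subgroupV (F_gr w) (Ff k).
  - exact: F_comm (Ff k) (Fg k).
split=> [w f g|w f|w v f g] fP; [move=> gP | | move=> gP].
- have [Ff df] := fP; have [Fg dg] := gP; split=> [k|]; first exact: subgroupM.
  rewrite (_ : diff _ = fun k => diff f k * ([~ diff f k, g k] * diff g k)).
    apply: (IHM _ _ _ df); apply: IHM dg.
    apply: poly_seq_le (IHR _ _ _ _ df (poly_seqW gP)).
    exact: leq_addr.
  by apply/funext => k; rewrite /diff; gsimpl.
- have [Ff df] := fP; split=> [k|]; first exact: subgroupV.
  have fP' := poly_seqW fP.
  rewrite (_ : diff _ = fun k => (diff f k)^-1 * [~ (diff f k)^-1, (f k)^-1]).
    apply: (IHM _ _ _ (IHV _ _ df)).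
    apply: poly_seq_le (IHR _ _ _ _ (IHV _ _ df) (IHV _ _ fP')).
    exact: leq_addr.
  by apply/funext => k; rewrite /diff; gsimpl.
- have [Ff df] := fP; have [Fg dg] := gP; split=> [k|]; first exact: F_comm.
  have fP' := poly_seqW fP; have gP' := poly_seqW gP.
  pose fg k := [~ f k, g k]; pose fdg k := [~ f k, diff g k].
  (* Expansion of [~ f * diff f, g * diff g], where the leading factor [~ f, g]
     cancels. *)
  rewrite (_ : diff _ = fun k => fdg k * [~ fdg k, fg k] * [~ fg k, diff g k] *
    ([~ fdg k * (fg k * [~ fg k, diff g k]), diff f k] *
     [~ diff f k, g k * diff g k])).
    have fgP : poly_seq p (w + v) d fg by apply: (IHR w).
    have fdgP : poly_seq p (w + v + p) d fdg by rewrite -addnA; apply: (IHR w).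
    have fgdgP : poly_seq p (w + v + p) d (fun k => [~ fg k, diff g k]).
      apply: poly_seq_le (IHR _ _ _ _ fgP dg).
      by rewrite addnA leq_add2r leq_addr.
    apply: (IHM (w + v + p)); first apply: (IHM _ _ _ _ fgdgP).
      apply: (IHM _ _ _ fdgP); apply: poly_seq_le (IHR _ _ _ _ fdgP fgP).
      exact: leq_addr.
    apply: (IHM (w + v + p)).
      apply: (@poly_seq_le _ (w + v + (w + p))); first by rewrite addnCA leq_addl.
      apply: (IHR _ _ _ _ _ df); apply: (IHM (w + v)).
        by apply: poly_seq_le fdgP; exact: leq_addr.
      apply: (IHM _ _ _ fgP); apply: poly_seq_le fgdgP; exact: leq_addr.
    rewrite addnAC; apply: (IHR _ _ _ _ df); apply: (IHM v) => //.
    by apply: poly_seq_le dg; exact: leq_addr.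
  by apply/funext => k; rewrite /diff /fdg /fg; gsimpl.
Qed.

Lemma poly_seqM w d f g : poly_seq p w d f -> poly_seq p w d g ->
  poly_seq p w d (fun k => f k * g k).
Proof. by have [+ _ _] := poly_seq_closed d; apply. Qed.

Lemma poly_seqV w d f : poly_seq p w d f -> poly_seq p w d (fun k => (f k)^-1).
Proof. by have [_ + _] := poly_seq_closed d; apply. Qed.

Lemma poly_seqR w v d f g : poly_seq p w d f -> poly_seq p v d g ->
  poly_seq p (w + v) d (fun k => [~ f k, g k]).
Proof. by have [_ _] := poly_seq_closed d; apply. Qed.

(** By Pascal's rule, the difference of c ^+ 'C(k, j) is c ^+ 'C(k, j - 1). *)
Lemma poly_seq_bin w d j c : F (w + p * j) c -> poly_seq p w d (fun k => c ^+ 'C(k, j)).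
Proof.
elim: d w j c => [|d IHd] w j c Fc; (split=> [k|//]);
  try by apply: subgroupX (F_gr w) (filtration_le _ Fc); exact: leq_addr.
case: j Fc => [|j] Fc.
  rewrite (_ : diff _ = fun k => 1 ^+ 'C(k, 0)).
    exact: (IHd _ 0 _ (subgroup1 (F_gr _))).
  by apply/funext => k; rewrite /diff !bin0; gsimpl.
rewrite (_ : diff _ = fun k => c ^+ 'C(k, j)).
  by apply: IHd; rewrite -addnA -mulnS.
by apply/funext => k; rewrite /diff binS expgnDr mulKg.
Qed.

(** If f is trivial at k, ..., k + d - 1, then f (k + d) is its d-th difference
    at k. *)
Lemma poly_seq_vanish w d f k : poly_seq p w d f ->
  (forall j, j < d -> f (k + j) = 1) -> F (w + p * d) (f (k + d)).
Proof.
elim: d w f => [|d IHd] w f fP f0; first by rewrite muln0 !addn0; case: fP.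
have [_ df] := fP.
have := IHd _ _ df; rewrite /diff f0 // invg1 mul1g addnS -addnA -mulnS; apply.
by move=> j lt_jd; rewrite -addnS !f0 ?invg1 ?mulg1 // ltnW.
Qed.

(** Taylor expansion, read modulo N. If f is trivial before j0, then
    k |-> (f j0) ^- 'C(k, j0) * f k is again polynomial and trivial before j0 + 1.
    Iterating past m writes f m as a product of powers c ^+ 'C(m, j), j >= j0; as
    only the value at m matters, this stops without any nilpotency assumption. *)
Lemma poly_seq_value_mem w f j0 m N : subgroup N ->
    (forall d, poly_seq p w d f) ->
    (forall k, k < j0 -> f k = 1) ->
    (forall j c, j0 <= j -> F (w + p * j) c -> N (c ^+ 'C(m, j))) ->
  N (f m).
Proof.
move=> N_gr; have [t le_t] := ubnP (m.+1 - j0)%N.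
elim: t => // t IHt in f j0 le_t * => fP f0 Nc.
have [lt_mj|le_jm] := ltnP m j0; first by rewrite f0 //; apply: subgroup1.
have Fc : F (w + p * j0) (f j0).
  by have := poly_seq_vanish (k := 0) (fP j0); rewrite add0n; apply=> j /f0.
rewrite -[f m](mulVKg (f j0 ^+ 'C(m, j0))).
apply: subgroupM => //; first exact: Nc.
pose g k := (f j0 ^+ 'C(k, j0))^-1 * f k.
apply: (IHt g j0.+1) => [|d|k|j c lt_j0j].
- by rewrite subSS; move: le_t; rewrite subSn // ltnS.
- by apply: poly_seqM (fP d); apply/poly_seqV/poly_seq_bin.
- rewrite ltnS leq_eqVlt /g => /orP[/eqP->|lt_kj]; first by rewrite binn mulVg.
  by rewrite bin_small // (f0 k) // expg0 mulg1 invg1.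
- exact/Nc/ltnW.
Qed.

End PolynomialSequences.

(** * The lower central series *)

Section LowerCentral.
Variable G : groupType.
Local Notation gam := (lower_central G).
Implicit Types (x y z : G) (i j n : nat).

Lemma lower_central_normal i : normal (gam i).
Proof.
elim: i => [|[|i] IHi]; [exact: setT_normal..|].
exact: commutator_subgroup_normal IHi (setT_normal G).
Qed.

Lemma lower_centralS i x z : gam i x -> gam i.+1 [~ x, z].
Proof.
case: i => [//|i] gx; apply: mem_generated.
by exists x => //; exists z.
Qed.

Lemma lower_central_desc i : gam i.+1 `<=` gam i.
Proof.
case: i => // i; apply: generated_sub.
  exact/normal_subgroup/lower_central_normal.
by move=> _ [x gx [z _ <-]]; apply: normal_commg_l => //; apply: lower_central_normal.
Qed.

Lemma Hall_Witt x y z :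
  [~ x, y^-1, z] ^ y * [~ y, z^-1, x] ^ z * [~ z, x^-1, y] ^ x = 1.
Proof. by gsimpl. Qed.

Lemma lower_central_subgroup i : subgroup (gam i).
Proof. exact: normal_subgroup (lower_central_normal i). Qed.

(** Three subgroups argument: by the Hall-Witt identity, [~ u, v, y] is a product
    of conjugates of inverses of [~ v^-1, y^-1, u] and [~ y, u^-1, v^-1], to which
    the induction on i applies. *)
Lemma lower_central_comm i j x y : gam i x -> gam j y -> gam (i + j) [~ x, y].
Proof.
have swap k s t : gam k [~ s, t] -> gam k [~ t, s].
  by rewrite -(invgR s t) => /subgroupV; apply; apply: lower_central_subgroup.
elim: i j x y => [|[|i] IHi] j x y gx gy.
- exact: swap (normal_commg_l _ (lower_central_normal j) gy).
- by rewrite add1n; apply: swap; apply: lower_centralS.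
have N_nor := lower_central_normal (i.+2 + j).
apply: (commutator_generated N_nor) gx gy => {}x {}y [u gu [v _ <-]] gy.
have {}gu : gam i.+1 u by [].
have [N_gr NJ] := N_nor.
have B_mem : gam (i.+2 + j) [~ v^-1, y^-1, u].
  rewrite addSnnS; apply/swap/IHi => //; apply/swap/lower_centralS.
  exact: subgroupV (lower_central_subgroup j) gy.
have C_mem : gam (i.+2 + j) [~ y, u^-1, v^-1].
  rewrite addSn; apply/lower_centralS/swap/IHi => //.
  exact: subgroupV (lower_central_subgroup _) gu.
have := Hall_Witt u v^-1 y; rewrite invgK -mulgA => /mulg1_eq eqA.
rewrite -(conjgKV v [~ u, v, y]); apply: (NJ).
rewrite -[X in _ X]invgK eqA.
exact: subgroupV N_gr (subgroupM N_gr (NJ _ _ B_mem) (NJ _ _ C_mem)).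
Qed.

End LowerCentral.

(** * The subgroup generated by the powers of the lower central series *)

Section Filtration.
Variables (G : groupType) (a : nat -> nat).
Local Notation gam := (lower_central G).
Local Notation e := (e_coef a).
Implicit Types (x y z u : G) (i j k n m : nat) (N : set G).

Let g_gr i : subgroup (gam i) := lower_central_subgroup G i.

(** Letting i range over all of nat is harmless: the terms with i > n lie in
    gamma_n, for which the exponent is 1, and the term with i = 0 is trivial as
    e(n, 0) = 0 for n > 0. It avoids boundary cases in the divisibility arguments. *)
Definition lower_central_powers n : set G :=
  generated [set x | exists i y, gam i y /\ x = y ^+ e n i].
Local Notation M := lower_central_powers.

Lemma lower_central_powers_normal n : normal (M n).
Proof.
apply: generated_normal => _ z [i [y [gy ->]]].
exists i, (y ^ z); rewrite conjXg; split=> //.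
by have [_] := lower_central_normal G i; apply.
Qed.

Let M_gr n : subgroup (M n) := normal_subgroup (lower_central_powers_normal n).

Lemma mem_lower_central_powers n i y m : gam i y -> e n i %| m -> M n (y ^+ m).
Proof.
move=> gy dvd_m; apply: subgroupX_dvd (M_gr n) dvd_m _.
by apply: mem_generated; exists i, y.
Qed.

Let g_desc := @lower_central_desc G.
Let g_comm := @lower_central_comm G.

Lemma poly_seq_expg i w x d : gam (w + i) x -> poly_seq gam i w d (fun k => x ^+ k).
Proof.
move=> gx; rewrite (_ : (fun k => _) = fun k => x ^+ 'C(k, 1)).
  by apply: (poly_seq_bin g_gr g_desc); rewrite muln1.
by apply/funext => k; rewrite bin1.
Qed.

(** The constant z is polynomial of weight 1 for any step p, and k |-> y ^+ k is
    polynomial of weight 0 for the step i: the weights add up. *)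
Lemma poly_seq_commg_expg i y z d : gam i y ->
  poly_seq gam i 1 d (fun k => [~ y ^+ k, z]).
Proof.
move=> gy; apply: (poly_seqR g_gr g_desc g_comm (w := 0)); first exact: poly_seq_expg.
rewrite (_ : (fun k => z) = fun k => z ^+ 'C(k, 0)).
  by apply: (poly_seq_bin g_gr g_desc); rewrite muln0.
by apply/funext => k; rewrite bin0.
Qed.

(** The expansion of k |-> [~ y ^+ k, z], which is trivial at k = 0. *)
Lemma commg_expg_mem N i m y z : subgroup N -> gam i y ->
    (forall j c, 0 < j -> gam (i * j).+1 c -> N (c ^+ 'C(m, j))) ->
  N [~ y ^+ m, z].
Proof.
move=> N_gr gy Nc.
apply: (poly_seq_value_mem g_gr g_desc g_comm (p := i) (w := 1) (j0 := 1)
          (f := fun k => [~ y ^+ k, z])) => // [d|[|//] _].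
- exact: poly_seq_commg_expg.
- by rewrite expg0 comm1g.
Qed.

(** Comparing [~ y ^+ k, z] with [~ y, z] ^+ k, which agree for k = 0, 1, leaves
    only the terms with j >= 2. *)
Lemma expg_commg_mem N i m y z : subgroup N -> gam i y ->
    (forall j c, 1 < j -> gam (i * j).+1 c -> N (c ^+ 'C(m, j))) ->
  N [~ y ^+ m, z] -> N ([~ y, z] ^+ m).
Proof.
move=> N_gr gy Nc Nyz.
suff: N ([~ y ^+ m, z]^-1 * [~ y, z] ^+ m).
  by move=> /(subgroupM N_gr Nyz); rewrite mulVKg.
apply: (poly_seq_value_mem g_gr g_desc g_comm (p := i) (w := 1) (j0 := 2)
          (f := fun k => [~ y ^+ k, z]^-1 * [~ y, z] ^+ k)) => // [d|[|[|//]] _].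
- apply: (poly_seqM g_gr g_desc g_comm).
    by apply: (poly_seqV g_gr g_desc g_comm); apply: poly_seq_commg_expg.
  by apply: poly_seq_expg; rewrite add1n; apply: lower_centralS.
- by rewrite !expg0 comm1g mulVg.
- by rewrite !expg1 mulVg.
Qed.

(** A form of the Hall-Petrescu formula: (x * y) ^+ k and x ^+ k * y ^+ k agree for
    k = 0, 1. *)
Lemma expgM_mem N i m x y : subgroup N -> gam i x -> gam i y ->
    (forall j c, 1 < j -> gam (i * j) c -> N (c ^+ 'C(m, j))) ->
  N (x ^+ m) -> N (y ^+ m) -> N ((x * y) ^+ m).
Proof.
move=> N_gr gx gy Nc Nx Ny.
suff: N ((x ^+ m * y ^+ m)^-1 * (x * y) ^+ m).
  by move=> /(subgroupM N_gr (subgroupM N_gr Nx Ny)); rewrite mulVKg.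
apply: (poly_seq_value_mem g_gr g_desc g_comm (p := i) (w := 0) (j0 := 2)
  (f := fun k => (x ^+ k * y ^+ k)^-1 * (x * y) ^+ k)) => // [d|[|[|//]] _].
- apply: (poly_seqM g_gr g_desc g_comm).
    apply: (poly_seqV g_gr g_desc g_comm); apply: (poly_seqM g_gr g_desc g_comm);
    exact: poly_seq_expg.
  by apply: poly_seq_expg; apply: subgroupM (g_gr i) gx gy.
- by rewrite !expg0 !mulg1 invg1.
- by rewrite !expg1 mulVg.
Qed.

Lemma lower_central_le i j x : i <= j -> gam j x -> gam i x.
Proof. exact: filtration_le g_desc _ _ _. Qed.

(** The j-th term of the expansion of [~ y ^+ e(n, i), z] is the 'C(e(n, i), j)-th
    power of an element of gamma_(i j + 1), and e(n+1, i j + 1) %| e(n, i j). *)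
Lemma commg_lower_central_powers n u z : 0 < n -> M n u -> M n.+1 [~ u, z].
Proof.
move=> n_gt0 Mu.
apply: (commutator_generated (lower_central_powers_normal n.+1) (K := setT)) Mu _ => //.
move=> _ {}z [[|i] [y [gy ->]]] _.
  by rewrite e_coef0 // expg0 comm1g; apply: subgroup1 (M_gr _).
apply: commg_expg_mem (M_gr _) gy _ => j c j_gt0 gc.
apply: mem_lower_central_powers gc _.
exact: dvdn_trans (e_coef_dvdSS _ _ n_gt0) (e_coef_dvd_bin _ n_gt0 _ j_gt0).
Qed.

(** Since M n is central modulo M n.+1, the powering map is a homomorphism there, so
    it is enough to look at generators. *)
Lemma expg_lower_central_powers n u : 0 < n -> M n u -> M n.+1 (u ^+ a n).
Proof.
move=> n_gt0.
suff: M n `<=` [set x | M n x /\ M n.+1 (x ^+ a n)] by move=> MM /MM[].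
apply: generated_sub => [|_ [i [y [gy ->]]]]; last first.
  split; first exact: mem_lower_central_powers gy _.
  rewrite -expgnA; apply: mem_lower_central_powers gy _.
  case: i => [|i]; first by rewrite !e_coef0.
  by rewrite e_coef_rec // mulnC dvdn_gcdl.
apply/subgroupP; split=> [|x y [Mx Mxa] [My Mya]|x [Mx Mxa]]; split.
- exact: subgroup1 (M_gr _).
- by rewrite expg1n; apply: subgroup1 (M_gr _).
- exact: subgroupM (M_gr _) Mx My.
- apply: expgM_mod (lower_central_powers_normal _) _ Mxa Mya => k.
  apply: commg_lower_central_powers => //.
  exact: subgroupV (M_gr _) (subgroupX _ (M_gr _) My).
- exact: subgroupV (M_gr _) Mx.
- by rewrite expVgn; apply: subgroupV (M_gr _) Mxa.
Qed.

Section NextTerm.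
Variables (n : nat) (K : set G).
Hypothesis n_gt0 : 0 < n.
Hypothesis K_gr : subgroup K.
Hypothesis K_power : forall u, M n u -> K (u ^+ a n).
Hypothesis K_comm : forall u z, M n u -> K [~ u, z].

(** Descending induction on i. As e(n+1, i) is a gcd, two powers of x are needed.
    The first, x ^+ (a n * e(n, i)), is in K by [K_power]. For the second,
    x ^+ e(n, i - 1), the case of a commutator x = [~ y, z] with y in gamma_(i - 1)
    follows from [K_comm], as [~ y ^+ e(n, i - 1), z] is in K; this and the passage
    to products of commutators involve corrections in deeper terms, which are in K
    by induction. *)
Lemma expg_lower_central_next i x : gam i x -> K (x ^+ e n.+1 i).
Proof.
have [t le_t] := ubnP (n.+1 - i); elim: t => // t IHt in i x le_t * => gx.
have [lt_ni|le_in] := ltnP n i.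
  apply: subgroupX => //; move: (lower_central_le lt_ni gx).
  case: n n_gt0 K_comm => // n' _ Kc; apply: generated_sub => //.
  move=> _ [u gu [z _ <-]]; have {}gu : gam n'.+1 u by [].
  apply: Kc; rewrite -[u]expg1.
  by apply: mem_lower_central_powers gu _; rewrite e_coef_ge.
case: i => [|i] in le_t gx le_in *.
  by rewrite e_coef0 // expg0; apply: subgroup1.
rewrite e_coef_rec //; apply: subgroupX_gcdn => //.
  rewrite mulnC expgnA; apply: K_power; exact: mem_lower_central_powers gx _.
case: i => [|i] in le_t gx le_in *.
  by rewrite e_coef0 // expg0; apply: subgroup1.
(* The correction terms: at depth l > (i + 1) j, the exponent e(n+1, l) divides
   e(n, l - 1), hence e(n, (i + 1) j), hence 'C(e(n, i + 1), j). *)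
have Kbin j l c : 1 < j -> i.+1 * j < l -> gam l c -> K (c ^+ 'C(e n i.+1, j)).
  case: l => // l j_gt1; rewrite ltnS => le_l gc.
  apply: subgroupX_dvd K_gr _ (IHt l.+1 _ _ gc).
    apply: dvdn_trans (e_coef_dvdSS _ _ n_gt0) _.
    apply: dvdn_trans (e_coef_dvd _ n_gt0 le_l) _.
    by apply: e_coef_dvd_bin => //; apply: ltnW.
  have lt_il : i.+1 < l.
    by apply: leq_trans le_l; rewrite ltn_Pmulr.
  by rewrite -ltnS; apply: leq_trans le_t; rewrite ltnS ltn_sub2l // ltnS.
suff: gam i.+2 `<=` [set x | gam i.+2 x /\ K (x ^+ e n i.+1)] by move=> /(_ x gx)[].
apply: generated_sub => [|_ [y gy [z _ <-]]]; last first.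
  have {}gy : gam i.+1 y by [].
  split; first exact: lower_centralS.
  apply: (expg_commg_mem K_gr gy) => [j c j_gt1 gc|].
    exact: Kbin gc.
  by apply: K_comm; apply: mem_lower_central_powers gy _.
apply/subgroupP; split=> [|u v [gu Ku] [gv Kv]|u [gu Ku]]; split.
- exact: subgroup1 (g_gr i.+2).
- by rewrite expg1n; apply: subgroup1.
- exact: subgroupM (g_gr i.+2) gu gv.
- apply: expgM_mem K_gr gu gv _ Ku Kv => j c j_gt1 gc.
  by apply: Kbin gc => //; rewrite ltn_pmul2r // ltnW.
- exact: subgroupV (g_gr i.+2) gu.
- by rewrite expVgn; apply: subgroupV.
Qed.

End NextTerm.

(** * Both sides of the theorem *)

Lemma A_filtrationE n : 0 < n -> A_filtration G a n = M n.
Proof.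
elim: n => // -[|n] IHn _.
  apply/seteqP; split=> // x _; rewrite -[x]expg1.
  by apply: (@mem_lower_central_powers _ 1); rewrite ?e_coef_ge.
have M_nor := lower_central_powers_normal n.+1.
have pow_nor := power_subgroup_normal (a n.+1) M_nor.
have comm_nor := commutator_subgroup_normal M_nor (setT_normal G).
rewrite [LHS]/= -/(A_filtration G a n.+1) IHn //.
apply/seteqP; split.
  apply: set_mulg_sub => //; apply: generated_sub => //.
    by move=> _ [u Mu <-]; apply: expg_lower_central_powers.
  by move=> _ [u Mu [z _ <-]]; apply: commg_lower_central_powers.
have K_nor := set_mulg_normal pow_nor comm_nor.
have K_gr := normal_subgroup K_nor.
apply: generated_sub => // _ [i [y [gy ->]]].
apply: expg_lower_central_next gy => // u.
  move=> Mu; apply: sub_set_mulg_l; first exact: subgroup1 (normal_subgroup _).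
  by apply: mem_generated; exists u.
move=> z Mu; apply: sub_set_mulg_r; first exact: subgroup1 (normal_subgroup _).
by apply: mem_generated; exists u => //; exists z.
Qed.

Lemma big_power_subgroupE n : 0 < n ->
  \big[@set_mulg G/[set 1]]_(1 <= i < n.+1) power_subgroup (gam i) (e n i) = M n.
Proof.
move=> n_gt0; pose H i := power_subgroup (gam i) (e n i).
have H_nor i : normal (H i) by apply/power_subgroup_normal/lower_central_normal.
apply/seteqP; split.
  apply: (big_set_mulg_sub (H := H)) => // i _; apply: generated_sub => //.
  by move=> _ [y gy <-]; apply: mem_lower_central_powers gy _.
have P_gr := normal_subgroup (big_set_mulg_normal H_nor (index_iota 1 n.+1)).
apply: generated_sub => // _ [i [y [gy ->]]].
have [->|i_gt0] := posnP i; first by rewrite e_coef0 //; apply: subgroup1 P_gr.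
have [le_in|lt_ni] := leqP i n.
  apply: (sub_big_set_mulg H_nor (i := i)); first by rewrite mem_index_iota i_gt0.
  by apply: mem_generated; exists y.
apply: (sub_big_set_mulg H_nor (i := n)); first by rewrite mem_index_iota n_gt0 /=.
apply: mem_generated; exists y; first exact: lower_central_le (ltnW lt_ni) gy.
by rewrite !e_coef_ge // ltnW.
Qed.

End Filtration.

Theorem theorem7p4 (G : groupType) (a : nat -> nat) (n : nat) (hn : (1 <= n)%N) :
  A_filtration G a n =
  \big[@set_mulg G/[set 1]]_(1 <= i < n.+1)
    power_subgroup (lower_central G i) (e_coef a n i).
Proof. by rewrite A_filtrationE // big_power_subgroupE. Qed.
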